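(* Let $G$ be a connected graph of order $n\ge3$, size $m$ and maximum degree $\Delta$, and let $\alpha\in[0,1)$. Then \[E^{A_\alpha}(G)\ge\left(\alpha(\Delta+1)+\sqrt{\alpha^2(\Delta+1)^2+4\Delta(1-2\alpha)}\right)-\frac{4\alpha m}{n},\] with equality if and only if $G\cong K_{1,\Delta}$.
   Context: $A_\alpha(G)=\alpha D(G)+(1-\alpha)A(G)$, where $A(G)$ is the adjacency matrix and $D(G)$ the diagonal degree matrix of $G$; its eigenvalues are $\rho_1\ge\dots\ge\rho_n$, and $E^{A_\alpha}(G)=\sum_{i=1}^n\left|\rho_i-\frac{2\alpha m}{n}\right|$. $K_{1,\Delta}$ is the star with $\Delta$ leaves. *)

(* Defs.v *)
From HB Require Import structures.
From mathcomp Require Import all_boot all_order all_algebra.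
From mathcomp Require Import spectral.
From mathcomp.real_closed Require Import complex.

Set Implicit Arguments.
Unset Strict Implicit.
Unset Printing Implicit Defensive.

Import Order.TTheory GRing.Theory Num.Theory.
Local Open Scope ring_scope.

Record sgraph := SGraph {
  vertex :> finType;
  adj : rel vertex;
  adj_sym : symmetric adj;
  adj_irrefl : irreflexive adj }.

Section GraphDefs.
Variable G : sgraph.

Definition deg (x : G) : nat := #|[set y | adj x y]|.

Definition max_deg : nat := \max_(x : G) deg x.

Definition edges : {set {set G}} :=
  [set E : {set G} | [exists x, exists y, adj x y && (E == [set x; y])]].

Definition connected_graph : Prop :=
  (0 < #|G|)%N /\ forall x y : G, connect (@adj G) x y.

End GraphDefs.

Definition giso (G H : sgraph) : Prop :=
  exists2 f : G -> H, bijective f & forall x y, adj (f x) (f y) = adj x y.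

(* The centre of the star is vertex 0 of 'I_k.+1; the other k are leaves. *)
Definition star_adj (k : nat) : rel 'I_k.+1 :=
  fun i j => (i == ord0) (+) (j == ord0).

Lemma star_adj_sym k : symmetric (@star_adj k).
Proof. by move=> i j; rewrite /star_adj addbC. Qed.

Lemma star_adj_irrefl k : irreflexive (@star_adj k).
Proof. by move=> i; rewrite /star_adj addbb. Qed.

Definition star (k : nat) : sgraph :=
  SGraph (@star_adj_sym k) (@star_adj_irrefl k).

Section Spectrum.
Variables (R : rcfType) (n : nat).

Definition is_spectrum (M : 'M[R]_n) (rho : n.-tuple R) : bool :=
  sorted >=%R rho && (char_poly M == \prod_(x <- rho) ('X - x%:P)).

Lemma symmetric_spectrum_exists (M : 'M[R]_n) :
  M^T = M -> exists rho : n.-tuple R, is_spectrum M rho.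
Proof.
move=> symM; pose f : {rmorphism R -> R[i]} := real_complex R.
pose A := map_mx f M.
have hA : A \is hermsymmx.
  apply: realsym_hermsym.
    apply/is_hermitianmxP; rewrite expr0 scale1r map_mx_id //.
    by rewrite /A map_trmx symM.
  by apply/mxOverP => i j; rewrite mxE; apply/complex_realP; exists (M i j).
have /orthomx_spectralP AE := hermitian_normalmx hA.
have /mxOverP Dreal := hermitian_spectral_diag_real hA.
pose P := spectralmx A; pose Pp := map_mx polyC P.
pose D := diag_mx (spectral_diag A).
have PU : P \in unitmx by exact: spectral_unit.
have simD : char_poly A = char_poly D.
  have VP : map_mx polyC (invmx P) *m Pp = 1%:M.
    by rewrite -map_mxM mulVmx // map_mx1.
  rewrite /char_poly /char_poly_mx {1}AE !map_mxM.
  have -> : 'X%:M - map_mx polyC (invmx P) *m map_mx polyC D *m Pp =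
            map_mx polyC (invmx P) *m char_poly_mx D *m Pp.
    by rewrite mulmxBr mulmxBl scalar_mxC -[in RHS](mulmxA _ _ Pp) VP mulmx1.
  by rewrite !det_mulmx mulrC mulrA -det_mulmx (mulmx1C VP) det1 mul1r.
pose d := [tuple complex.Re (spectral_diag A 0 i) | i < n].
have dP : char_poly M = \prod_(x <- d) ('X - x%:P).
  apply: (map_poly_inj f).
  rewrite map_char_poly -/A simD char_poly_trig ?diag_mx_is_trig //.
  rewrite rmorph_prod /= big_map big_enum /=; apply: eq_bigr => i _.
  rewrite rmorphB /= map_polyX map_polyC /= mxE eqxx mulr1n.
  have /complex_realP [x ->] := Dreal 0 i.
  by [].
have szs : size (sort >=%R d) == n by rewrite size_sort size_tuple.
exists (Tuple szs); apply/andP; split.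
  by apply/sort_sorted => x y; exact: ge_total.
by rewrite dP; apply/eqP/perm_big; rewrite perm_sym perm_sort.
Qed.

Definition eigenvalues (M : 'M[R]_n) (symM : M^T = M) : n.-tuple R :=
  xchoose (symmetric_spectrum_exists symM).

End Spectrum.

Section AlphaMatrix.
Variables (R : rcfType) (G : sgraph).

Definition adj_mx : 'M[R]_#|G| :=
  \matrix_(i, j) (adj (enum_val i) (enum_val j))%:R.

Definition deg_mx : 'M[R]_#|G| := diag_mx (\row_i (deg (enum_val i))%:R).

Definition A_alpha (alpha : R) : 'M[R]_#|G| :=
  alpha *: deg_mx + (1 - alpha) *: adj_mx.

Lemma A_alpha_sym alpha : (A_alpha alpha)^T = A_alpha alpha.
Proof.
rewrite /A_alpha linearD /= !linearZ /= tr_diag_mx; congr (_ + _ *: _).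
by apply/matrixP => i j; rewrite !mxE adj_sym.
Qed.

Definition rho (alpha : R) (i : 'I_#|G|) : R :=
  tnth (eigenvalues (A_alpha_sym alpha)) i.

Definition energy (alpha : R) : R :=
  \sum_(i < #|G|) `|rho alpha i - 2 * alpha * #|edges G|%:R / #|G|%:R|.

End AlphaMatrix.

(* Main.v *)
Require Import Defs.
From mathcomp Require Import all_boot all_order all_algebra.
From mathcomp Require Import perm spectral ring lra.
From mathcomp.real_closed Require Import complex.
Import Order.TTheory GRing.Theory Num.Theory.
Local Open Scope ring_scope.

Set Implicit Arguments.
Unset Strict Implicit.
Unset Printing Implicit Defensive.

(** The eigenvalues average to 2 alpha m / n, so the energy is at least twice the
    excess of the largest eigenvalue over that mean, with equality when every other
    eigenvalue is at most the mean.  The Perron vector of the star on a vertex of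
    maximum degree and its neighbours, extended by zero, is a Rayleigh test vector
    showing that the largest eigenvalue of G is at least that of K_{1,Delta}; if the
    two agree, the test vector is an eigenvector, and connectedness then rules out
    further vertices and edges.  For the star itself, all eigenvalues but the largest
    are at most alpha, which is at most the mean because all degrees are positive. *)

(** * Spectral theorem and Rayleigh quotient for real symmetric matrices *)

Section SymmetricMatrices.
Local Open Scope complex_scope.
Local Open Scope sesquilinear_scope.

Variables (R : rcfType) (n : nat).
Implicit Types (M : 'M[R]_n) (rho : n.-tuple R).

Local Notation toC := (map_mx (real_complex R)).

(** Vieta: both sides are, up to sign, the subleading coefficient of the characteristic
    polynomial. *)
Lemma spectrum_trace M rho : is_spectrum M rho -> \sum_i tnth rho i = \tr M.
Proof.
case: n M rho => [|k] M rho /andP[_ /eqP E]; first by rewrite big_ord0 /mxtrace big_ord0.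
have := @coefPn_prod_XsubC R rho; rewrite size_tuple -E char_poly_trace //.
by move=> /(_ isT)/oppr_inj->; rewrite big_tuple.
Qed.

(** The spectral theorem lists the eigenvalues in an order of its own. Unique factorisation of the
    characteristic polynomial yields a permutation matching that list with [rho], and the rows of
    the diagonalising matrix are permuted accordingly. *)
Lemma spectrum_unitary_diag M rho : M^T = M -> is_spectrum M rho ->
  exists2 P : 'M[R[i]]_n, P \is unitarymx &
    P *m toC M = diag_mx (\row_i (tnth rho i)%:C) *m P.
Proof.
move=> symM /andP[_ /eqP charM]; pose A := toC M.
have hA : A \is hermsymmx.
  apply: realsym_hermsym.
    apply/is_hermitianmxP; rewrite expr0 scale1r map_mx_id //.
    by rewrite /A map_trmx symM.
  by apply/mxOverP => i j; rewrite mxE; apply/complex_realP; exists (M i j).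
have /orthomx_spectralP AE := hermitian_normalmx hA.
set P0 := spectralmx A in AE; set d := spectral_diag A in AE.
have P0U : P0 \in unitmx by exact: spectral_unit.
have P0A : P0 *m A = diag_mx d *m P0 by rewrite [in LHS]AE !mulmxA mulmxV // mul1mx.
have charA : char_poly A = \prod_(x <- [tuple d 0 i | i < n]) ('X - x%:P).
  have cP : \det (map_mx polyC P0) != 0.
    by rewrite det_map_mx polyC_eq0 -unitfE -unitmxE.
  have cE : map_mx polyC P0 *m char_poly_mx A =
      char_poly_mx (diag_mx d) *m map_mx polyC P0.
    by rewrite mulmxBr mulmxBl scalar_mxC -!map_mxM P0A.
  have /mulfI := cP; apply.
  rewrite /char_poly -det_mulmx cE det_mulmx mulrC; congr (_ * _).
  rewrite -/(char_poly _) char_poly_trig ?diag_mx_is_trig //.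
  rewrite big_map big_enum /=; apply: eq_bigr => i _.
  by rewrite mxE eqxx mulr1n.
have : perm_eq (map (real_complex R) rho) [tuple d 0 i | i < n].
  apply: prod_XsubC_eq; rewrite -charA /A -map_char_poly charM rmorph_prod big_map.
  by apply: eq_bigr => x _; rewrite rmorphB /= map_polyX map_polyC.
case/tuple_permP => p Ep.
have rhoE i : (tnth rho i)%:C = d 0 (p i).
  have := congr1 (fun s => nth 0 s i) Ep.
  rewrite (nth_map 0) ?size_tuple // (nth_map i) ?size_enum_ord //.
  by rewrite !tnth_mktuple nth_ord_enum (tnth_nth 0).
exists (row_perm p P0).
  apply/unitarymxP/matrixP => i j.
  have /unitarymxP/matrixP/(_ (p i) (p j)) := spectral_unitarymx A.
  rewrite !mxE (inj_eq perm_inj) => <-.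
  by apply: eq_bigr => k _; rewrite !mxE.
apply/matrixP => i j; rewrite mul_diag_mx !mxE rhoE.
move/matrixP/(_ (p i) j): P0A; rewrite mul_diag_mx !mxE => <-.
by apply: eq_bigr => k _; rewrite !mxE.
Qed.

(** With [y] the coordinates of [x] in a unitary eigenbasis, the form equals the sum of the
    nonnegative terms [(r - rho_i) |y_i|^2]. If it vanishes, so does each [(r - rho_i) y_i], and
    these are the coordinates of [r *: x - M *m x]. *)
Lemma rayleigh M rho (r : R) (x : 'cV[R]_n) :
    M^T = M -> is_spectrum M rho -> (forall i, tnth rho i <= r) ->
  0 <= (x^T *m (r *: x - M *m x)) 0 0 /\
  ((x^T *m (r *: x - M *m x)) 0 0 = 0 -> M *m x = r *: x).
Proof.
move=> symM specM ub; have [P PU PM] := spectrum_unitary_diag symM specM.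
set z := r *: x - M *m x; pose y := P *m toC x.
have zE : P *m toC z = \col_i ((r - tnth rho i)%:C * y i 0).
  rewrite /z map_mxB map_mxZ map_mxM mulmxBr mulmxA PM -scalemxAr -/y.
  rewrite -mulmxA -/y mul_diag_mx; apply/matrixP => i j.
  by rewrite ord1 !mxE rmorphB mulrBl.
have qE : ((x^T *m z) 0 0)%:C = \sum_i (r - tnth rho i)%:C * (y i 0 * Num.conj (y i 0)).
  have -> : ((x^T *m z) 0 0)%:C = ((toC x)^t* *m toC z) 0 0.
    rewrite !mxE rmorph_sum; apply: eq_bigr => i _.
    rewrite rmorphM !mxE; congr (_ * _).
    by rewrite conj_Creal //; apply/complex_realP; exists (x i 0).
  have PP : P^t* *m P = 1%:M by apply: mulmx1C; apply/unitarymxP.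
  have -> : (toC x)^t* *m toC z = y^t* *m (P *m toC z).
    by rewrite /y trmx_mul map_mxM -!mulmxA (mulmxA _ P) PP mul1mx.
  rewrite zE mxE; apply: eq_bigr => i _; rewrite !mxE.
  by rewrite mulrCA; congr (_ * _); rewrite mulrC.
have ge i : 0 <= (r - tnth rho i)%:C * (y i 0 * Num.conj (y i 0)).
  by rewrite mulr_ge0 ?mul_conjC_ge0 // lecR subr_ge0.
split; first by rewrite -lecR qE sumr_ge0.
move=> q0; have : \sum_i (r - tnth rho i)%:C * (y i 0 * Num.conj (y i 0)) = 0.
  by rewrite -qE q0.
move/(psumr_eq0P (fun i _ => ge i)) => z0.
have Pz : P *m toC z = 0.
  rewrite zE; apply/matrixP => i j; rewrite mxE [RHS]mxE.
  have /eqP := z0 i isT; rewrite !mulf_eq0 conjC_eq0 orbb => /orP[]/eqP->.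
    by rewrite mul0r.
  by rewrite mulr0.
have tz : toC z = 0.
  by rewrite -[toC z](mulKmx (unitarymx_unit PU)) Pz mulmx0.
apply/esym/eqP; rewrite -subr_eq0 -/z; apply/eqP/matrixP => i j.
by move/matrixP/(_ i j): tz; rewrite !mxE => -[].
Qed.

End SymmetricMatrices.

(** * Degree sums and a characterisation of stars *)

Section Graphs.
Variable G : sgraph.
Implicit Types x y c : G.

Lemma deg_sum (R : pzSemiRingType) x : (deg x)%:R = \sum_(y : G) (adj x y)%:R :> R.
Proof.
rewrite -natr_sum -big_mkcond /= sum1_card; congr (_%:R).
by apply: eq_card => y; rewrite inE.
Qed.

(** Double counting of incidences: for fixed [x], the map sending [y] to [[set x; y]] is a bijection
    from the neighbours of [x] to the edges containing [x]. *)
Lemma handshake : (\sum_(x : G) deg x = 2 * #|edges G|)%N.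
Proof.
transitivity (\sum_(E in edges G) \sum_(x in E) 1)%N; last first.
  rewrite mulnC -sum_nat_const; apply: eq_bigr => E.
  rewrite inE sum1_card => /existsP[x /existsP[y /andP[xy /eqP->]]].
  by rewrite cards2; case: eqVneq xy => // ->; rewrite adj_irrefl.
rewrite (exchange_big_dep predT) //=; apply: eq_bigr => x _.
rewrite sum1_card /deg.
rewrite -(card_in_imset (f := fun y => [set x; y])).
  apply: eq_card => E; rewrite [RHS]unfold_in [E \in edges G]inE; apply/imsetP/andP.
    case=> y; rewrite inE => xy ->; rewrite !inE eqxx; split => //.
    by apply/existsP; exists x; apply/existsP; exists y; rewrite xy /=.
  case=> /existsP[a /existsP[b /andP[ab /eqP->]]].
  rewrite !inE => /orP[]/eqP->; first by exists b; rewrite ?inE.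
  by exists a; rewrite ?inE 1?adj_sym // setUC.
move=> y z; rewrite !inE => xy xz /setP/(_ y); rewrite !inE eqxx orbT.
by case/esym/orP=> /eqP // yx; move: xy; rewrite yx adj_irrefl.
Qed.

(** Being a star with a designated centre, phrased inside [G] so that no isomorphism has to be
    carried along. *)
Definition star_at c := forall x y, adj x y = (x == c) (+) (y == c).

Lemma star_at_deg c : star_at c -> (deg c).+1 = #|G|.
Proof.
move=> sc; rewrite -(cardC (pred1 c)) card1 add1n; congr _.+1.
by apply: eq_card => y; rewrite !inE sc eqxx.
Qed.

(** No vertex is its own neighbour, so every degree is below [#|G|], which is [(deg c).+1]. *)
Lemma star_at_max_deg c : star_at c -> max_deg G = deg c.
Proof.
move=> sc; apply/anti_leq; rewrite leq_bigmax andbT; apply/bigmax_leqP => x _.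
rewrite -ltnS (star_at_deg sc) /deg -cardsT.
apply: proper_card; rewrite properE subsetT /=.
by apply/subsetPn; exists x; rewrite !inE ?adj_irrefl.
Qed.

Lemma giso_starP (D : nat) : D.+1 = #|G| -> giso G (star D) <-> exists c, star_at c.
Proof.
move=> DG; split.
  case=> f [g fK gK] fadj; exists (g ord0) => x y.
  by rewrite -fadj /= /star_adj !(can2_eq fK gK).
case=> c sc; pose r (x : G) := cast_ord (esym DG) (enum_rank x).
have rb : bijective r.
  exists (fun i => enum_val (cast_ord DG i)) => [x | i].
    by rewrite /r cast_ordKV enum_rankK.
  by rewrite /r enum_valK cast_ordK.
(* Any bijection will do once a transposition has sent the centre to vertex 0. *)
pose f x := tperm (r c) ord0 (r x).
have fb : bijective f by apply: bij_comp rb; exact: injF_bij perm_inj.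
exists f => // x y; rewrite /= /star_adj sc.
have E z : (f z == ord0) = (z == c).
  by rewrite -(inj_eq (bij_inj fb)) /f tpermL.
by rewrite !E.
Qed.

End Graphs.

(** * Trace of the matrix and its action on vectors indexed by vertices *)

Section AlphaMatrixAction.
Variables (R : rcfType) (G : sgraph) (alpha : R).
Implicit Types x y c : G.

Lemma A_alpha_trace : \tr (A_alpha G alpha) = 2 * alpha * #|edges G|%:R.
Proof.
rewrite mulrAC -natrM -handshake mulrC natr_sum mulr_sumr /mxtrace.
rewrite [RHS](reindex (@enum_val G predT)) /=; last exact/onW_bij/enum_val_bij.
by apply: eq_bigr => i _; rewrite !mxE eqxx adj_irrefl mulr0 addr0.
Qed.

(** The morphism [f] allows one statement to serve both real vectors and the complex rows of a
    unitary diagonaliser. *)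
Lemma A_alpha_sum (K : comNzRingType) (f : {rmorphism R -> K}) (u : G -> K) i :
  \sum_j f (A_alpha G alpha i j) * u (enum_val j) =
  f alpha * (deg (enum_val i))%:R * u (enum_val i)
  + f (1 - alpha) * \sum_(y : G) (adj (enum_val i) y)%:R * u y.
Proof.
rewrite [X in _ + _ * X](reindex (@enum_val G predT)) /=; last first.
  exact/onW_bij/enum_val_bij.
rewrite mulr_sumr [in LHS](eq_bigr (fun j : 'I_#|G| =>
  f alpha * ((deg (enum_val i))%:R *+ (i == j)) * u (enum_val j)
  + f (1 - alpha) * ((adj (enum_val i) (enum_val j))%:R * u (enum_val j)))).
  rewrite big_split /=; congr (_ + _).
  rewrite (bigD1 i) //= eqxx big1 ?addr0 // => j /negPf ji.
  by rewrite eq_sym ji mulr0 mul0r.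
by move=> j _; rewrite !mxE rmorphD !rmorphM !rmorphMn /= !rmorph1 mulrDl mulrA.
Qed.

(** Row vectors are the form in which [eigenvalue] and the rows of a diagonaliser provide
    eigenvectors; symmetry of the matrix turns the equation into the usual one at each vertex. *)
Lemma A_alpha_left_eigenvector (K : comNzRingType) (f : {rmorphism R -> K})
    (v : 'rV[K]_#|G|) (l : K) :
    v *m map_mx f (A_alpha G alpha) = l *: v ->
  forall x, f alpha * (deg x)%:R * v 0 (enum_rank x)
    + f (1 - alpha) * \sum_(y : G) (adj x y)%:R * v 0 (enum_rank y)
    = l * v 0 (enum_rank x).
Proof.
move=> E x; move/matrixP/(_ 0 (enum_rank x)): E; rewrite !mxE => <-.
have := A_alpha_sum f (fun y => v 0 (enum_rank y)) (enum_rank x).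
rewrite enum_rankK => <-; apply: eq_bigr => j _.
by rewrite enum_valK mulrC [map_mx _ _ _ _]mxE -{1}(A_alpha_sym G alpha) [_^T _ _]mxE.
Qed.

End AlphaMatrixAction.

(** * The quadratic equation for the spectral radius of a star *)

Section StarRadius.
Variables (R : rcfType) (alpha : R).
Implicit Types D l : R.
Hypothesis alpha01 : 0 <= alpha < 1.

(** The larger root of [(X - alpha) (X - alpha D) = D (1 - alpha)^2], the equation left after
    eliminating the leaf entry from the eigenvector equations of a star with [D] leaves. *)
Definition star_radius (D : R) : R :=
  (alpha * (D + 1)
   + Num.sqrt (alpha ^+ 2 * (D + 1) ^+ 2 + 4 * D * (1 - 2 * alpha))) / 2.

Lemma star_radius_root D : 0 <= D ->
  (star_radius D - alpha) * (star_radius D - alpha * D) = D * (1 - alpha) ^+ 2.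
Proof.
move=> D0; rewrite /star_radius; set d := _ + 4 * D * _.
have d0 : 0 <= d.
  (* As a sum of squares the radicand is nonnegative even when [1 - 2 * alpha] is negative. *)
  have -> : d = (alpha * (D - 1)) ^+ 2 + 4 * D * (1 - alpha) ^+ 2.
    by rewrite /d; ring.
  by rewrite addr_ge0 ?sqr_ge0 // mulr_ge0 ?sqr_ge0 // mulr_ge0 ?ler0n.
have := sqr_sqrtr d0; set s := Num.sqrt d => sE.
transitivity ((s ^+ 2 - (alpha * (D - 1)) ^+ 2) / 4); first by field.
by rewrite sE /d; field.
Qed.

Lemma star_radius_gt D : 0 < D -> alpha * D < star_radius D.
Proof.
move=> D0; rewrite /star_radius; case/andP: alpha01 => a0 a1.
set s := Num.sqrt _.
suff : alpha * (D - 1) < s by lra.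
have gt0 : 0 < 4 * D * (1 - alpha) ^+ 2.
  by rewrite mulr_gt0 ?exprn_gt0 ?subr_gt0 // mulr_gt0 ?ltr0n.
apply: le_lt_trans (ler_norm _) _; rewrite -sqrtr_sqr.
have -> : s = Num.sqrt ((alpha * (D - 1)) ^+ 2 + 4 * D * (1 - alpha) ^+ 2).
  by congr Num.sqrt; ring.
by rewrite ltr_sqrt ?ltrDl // ltr_wpDl ?sqr_ge0.
Qed.

Lemma star_radius_gt_alpha D : 1 <= D -> alpha < star_radius D.
Proof.
move=> D1; case/andP: alpha01 => a0 _.
by apply: le_lt_trans (star_radius_gt _); [rewrite ler_peMr | apply: lt_le_trans D1].
Qed.

(** The roots sum to [alpha * (D + 1)], and the larger one exceeds [alpha * D], so the other lies
    below [alpha]. *)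
Lemma star_radius_uniq D l : 1 <= D ->
  (l - alpha) * (l - alpha * D) = D * (1 - alpha) ^+ 2 ->
  l = star_radius D \/ l <= alpha.
Proof.
move=> D1; have D0 : 0 < D by exact: lt_le_trans D1.
rewrite -(star_radius_root (ltW D0)); set t := star_radius D => lE.
have : (l - t) * (l + t - alpha * (D + 1)) = 0.
  transitivity ((l - alpha) * (l - alpha * D) - (t - alpha) * (t - alpha * D)).
    by ring.
  by rewrite lE subrr.
move/eqP; rewrite mulf_eq0 subr_eq0 => /orP[/eqP|/eqP E]; first by left.
by right; have := star_radius_gt D0; rewrite -/t; lra.
Qed.

End StarRadius.

(** * The Rayleigh bound from the star at a vertex, and its equality case *)

Section LowerBound.
Variables (R : rcfType) (G : sgraph) (alpha : R) (c : G).
Hypotheses (alpha01 : 0 <= alpha < 1) (deg_gt0 : (0 < deg c)%N).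
Implicit Types x y : G.

Local Notation t := (star_radius alpha (deg c)%:R).

(* The Perron vector of the star formed by [c] and its neighbours, extended by 0. *)
Definition star_vector x : R :=
  if x == c then t - alpha else if adj c x then 1 - alpha else 0.

Definition A_alpha_act (u : G -> R) x : R :=
  alpha * (deg x)%:R * u x + (1 - alpha) * \sum_(y : G) (adj x y)%:R * u y.

Let a0 : 0 <= alpha. Proof. by case/andP: alpha01. Qed.
Let a1 : 0 < 1 - alpha. Proof. by rewrite subr_gt0; case/andP: alpha01. Qed.
Let D1 : 1 <= (deg c)%:R :> R. Proof. by rewrite ler1n. Qed.

Lemma star_vector_center_gt0 : 0 < t - alpha.
Proof. by rewrite subr_gt0; exact: star_radius_gt_alpha. Qed.

Lemma star_vector_ge0 x : 0 <= star_vector x.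
Proof.
by rewrite /star_vector; do 2?case: ifP => // _; rewrite ltW // star_vector_center_gt0.
Qed.

Lemma star_vector_gt0 x : (x == c) || adj c x -> 0 < star_vector x.
Proof.
by rewrite /star_vector; case: eqP => _ /=; [rewrite star_vector_center_gt0 | move=> ->].
Qed.

Let term_ge0 x y : 0 <= (adj x y)%:R * star_vector y.
Proof. by rewrite mulr_ge0 ?ler0n ?star_vector_ge0. Qed.

(** The eigenvector equation of the star at a leaf. *)
Lemma leaf_balance : t * (1 - alpha) = alpha * (1 - alpha) + (1 - alpha) * (t - alpha).
Proof. ring. Qed.

Lemma star_vector_sum_center :
  \sum_(y : G) (adj c y)%:R * star_vector y = (deg c)%:R * (1 - alpha).
Proof.
rewrite deg_sum mulr_suml; apply: eq_bigr => y _; rewrite /star_vector.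
by case: eqVneq => [->|_]; [rewrite adj_irrefl !mul0r | case: ifP; rewrite ?mul0r].
Qed.

(** The centre gives equality, by the quadratic equation. At a neighbour of [c], further edges only
    raise the degree and add nonnegative terms; elsewhere the left side is zero. *)
Lemma star_vector_subinvariant x : t * star_vector x <= A_alpha_act star_vector x.
Proof.
rewrite /A_alpha_act {1 2}/star_vector; case: eqVneq => [->|xc].
  rewrite star_vector_sum_center.
  rewrite le_eqVlt; apply/orP; left; apply/eqP.
  transitivity ((t - alpha) * (t - alpha * (deg c)%:R)
    + alpha * (deg c)%:R * (t - alpha)); first by ring.
  by rewrite (star_radius_root alpha (ler0n _ _)); ring.
case: ifP => cx; last first.
  by rewrite !mulr0 add0r mulr_ge0 ?(ltW a1) ?sumr_ge0.
rewrite leaf_balance lerD //.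
  rewrite ler_wpM2r ?(ltW a1) // ler_peMr // ler1n /deg card_gt0.
  by apply/set0Pn; exists c; rewrite inE adj_sym.
rewrite ler_wpM2l ?(ltW a1) // (bigD1 c) //= adj_sym cx mul1r {1}/star_vector eqxx.
by rewrite lerDl sumr_ge0.
Qed.

Lemma star_vector_eigen_star :
    (forall x y, connect (@adj G) x y) ->
    (forall x, A_alpha_act star_vector x = t * star_vector x) ->
  star_at c.
Proof.
move=> conn eig.
(* At a vertex outside the closed neighbourhood of [c] the equation says that the entries of its
   neighbours sum to zero, so it has no neighbour inside, where entries are positive. *)
have clos : closed (@adj G) [pred x | (x == c) || adj c x].
  apply: intro_closed; first exact: sym_connect_sym (@adj_sym G).
  move=> x y xy; rewrite !inE => /star_vector_gt0 x0.
  apply: contraTT xy; rewrite negb_or => /andP[yc cy].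
  move: (eig y); rewrite /A_alpha_act {1 3}/star_vector (negPf yc) (negPf cy).
  rewrite !mulr0 add0r => /eqP; rewrite mulf_eq0 (gt_eqF a1) /= => /eqP.
  move/(psumr_eq0P (fun i _ => term_ge0 y i))/(_ x isT)/eqP.
  by rewrite mulf_eq0 (gt_eqF x0) orbF pnatr_eq0 eqb0 adj_sym.
have all_nb x : (x == c) || adj c x.
  by have := closed_connect clos (conn c x); rewrite !inE eqxx /= => <-.
have leaf x : x != c -> adj c x by move=> xc; have := all_nb x; rewrite (negPf xc).
(* An edge between two leaves would add a positive term to the leaf equation, which is already
   balanced by the centre alone. *)
have noedge x y : x != c -> y != c -> adj x y = false.
  move=> xc yc; apply/negbTE/negP => xy.
  have := eig x; rewrite /A_alpha_act {1 3}/star_vector (negPf xc) leaf //.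
  rewrite (bigD1 c) //= (bigD1 y) //= adj_sym leaf // xy !mul1r {1}/star_vector eqxx.
  rewrite leaf_balance => E.
  have dx : 1 <= (deg x)%:R :> R.
    by rewrite ler1n /deg card_gt0; apply/set0Pn; exists y; rewrite inE.
  have h1 : alpha * (1 - alpha) <= alpha * (deg x)%:R * (1 - alpha).
    by rewrite ler_wpM2r ?(ltW a1) // ler_peMr.
  have h2 : 0 < (1 - alpha) * star_vector y.
    by rewrite mulr_gt0 // star_vector_gt0.
  have h3 : 0 <= (1 - alpha) *
      \sum_(i | (i != c) && (i != y)) (adj x i)%:R * star_vector i.
    by rewrite mulr_ge0 ?(ltW a1) ?sumr_ge0.
  by move: E; rewrite !mulrDr; lra.
move=> x y; case: (eqVneq x c) => [->|xc]; case: (eqVneq y c) => [->|yc] /=.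
- exact: adj_irrefl.
- exact: leaf.
- by rewrite adj_sym leaf.
- exact: noedge.
Qed.

Lemma star_radius_le (rho : #|G|.-tuple R) (r : R) :
    is_spectrum (A_alpha G alpha) rho -> (forall i, tnth rho i <= r) ->
    (forall x y, connect (@adj G) x y) ->
  t <= r /\ (r = t -> star_at c).
Proof.
move=> specA ub conn; pose X : 'cV[R]_#|G| := \col_i star_vector (enum_val i).
have AX i : (A_alpha G alpha *m X) i 0 = A_alpha_act star_vector (enum_val i).
  rewrite mxE -[RHS](A_alpha_sum alpha (idfun : {rmorphism R -> R})).
  by apply: eq_bigr => j _; rewrite [X j 0]mxE.
have [] := rayleigh X (A_alpha_sym G alpha) specA ub.
set q := (_ *m _) 0 0 => q0 q1.
have qE : q = \sum_(i < #|G|) star_vector (enum_val i) *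
    (r * star_vector (enum_val i) - A_alpha_act star_vector (enum_val i)).
  rewrite /q mxE; apply: eq_bigr => i _.
  rewrite [X^T _ _]mxE [X i 0]mxE [(r *: X - _) i 0]mxE [(r *: X) i 0]mxE ?[X i 0]mxE.
  by rewrite [(- (_ *m _)) i 0]mxE AX.
(* Together with [q0] this traps [q] between 0 and [(r - t)] times a positive norm; when [r = t] it
   forces [q = 0], the equality case of [rayleigh]. *)
have qle : q <= (r - t) * \sum_(i < #|G|) star_vector (enum_val i) ^+ 2.
  rewrite qE mulr_sumr ler_sum // => i _.
  rewrite expr2 mulrCA ler_wpM2l ?star_vector_ge0 // mulrBl lerD2l lerN2.
  exact: star_vector_subinvariant.
have n0 : 0 < \sum_(i < #|G|) star_vector (enum_val i) ^+ 2.
  rewrite (bigD1 (enum_rank c)) //= enum_rankK ltr_pwDl ?sumr_ge0 //.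
    by rewrite exprn_gt0 // star_vector_gt0 // eqxx.
  by move=> i _; rewrite sqr_ge0.
split.
  by have := le_trans q0 qle; rewrite pmulr_lge0 // subr_ge0.
move=> rt; apply: star_vector_eigen_star => // x.
have /q1 : q = 0 by apply/le_anti; rewrite q0 andbT; move: qle; rewrite rt subrr mul0r.
move/matrixP/(_ (enum_rank x) 0); rewrite AX enum_rankK => ->.
by rewrite mxE [X _ _]mxE enum_rankK rt.
Qed.

End LowerBound.

(** * Eigenvalues of the star and simplicity of the largest one *)

Section StarSpectrum.
Local Open Scope complex_scope.

Variables (R : rcfType) (G : sgraph) (alpha : R) (c : G).
Hypotheses (alpha01 : 0 <= alpha < 1) (deg_gt0 : (0 < deg c)%N) (sc : star_at c).
Variable rho : #|G|.-tuple R.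
Hypothesis spec_rho : is_spectrum (A_alpha G alpha) rho.

Local Notation t := (star_radius alpha (deg c)%:R).

Let D1 : 1 <= (deg c)%:R :> R. Proof. by rewrite ler1n. Qed.

Section Eigenvector.
Variables (K : fieldType) (f : {rmorphism R -> K}) (v : 'rV[K]_#|G|) (l : K).
Hypothesis eig : v *m map_mx f (A_alpha G alpha) = l *: v.

Local Notation w x := (v 0 (enum_rank x)).

Lemma star_eigenvector_leaf (x : G) :
  x != c -> (l - f alpha) * w x = f (1 - alpha) * w c.
Proof.
move=> xc; rewrite mulrBl -(A_alpha_left_eigenvector eig x) deg_sum.
have adjE y : (adj x y) = (y == c) by rewrite sc (negPf xc).
have one : \sum_(y : G) (adj x y)%:R = 1 :> K.
  by rewrite (bigD1 c) //= adjE eqxx big1 ?addr0 // => y /negPf yc; rewrite adjE yc.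
rewrite one mulr1 addrC addKr; congr (_ * _).
rewrite (bigD1 c) //= adjE eqxx mul1r big1 ?addr0 // => y /negPf yc.
by rewrite adjE yc mul0r.
Qed.

Lemma star_eigenvector_center :
  (l - f alpha * (deg c)%:R) * w c = f (1 - alpha) * \sum_(y | y != c) w y.
Proof.
rewrite mulrBl -(A_alpha_left_eigenvector eig c) addrC addKr.
congr (_ * _); rewrite [RHS]big_mkcond; apply: eq_bigr => y _.
by rewrite sc eqxx; case: eqVneq; rewrite ?mul1r ?mul0r.
Qed.

(** Away from [f alpha], the leaf equation determines every leaf entry from the entry at the
    centre. *)
Lemma star_eigenvector_eq0 : l != f alpha -> w c = 0 -> v = 0.
Proof.
move=> la wc; apply/matrixP => i j; rewrite ord1 mxE -(enum_valK j).
have [->//|jc] := eqVneq (enum_val j) c.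
have /eqP := star_eigenvector_leaf jc.
by rewrite wc mulr0 mulf_eq0 subr_eq0 (negPf la) => /eqP.
Qed.

End Eigenvector.

(** For an eigenvalue other than [alpha], substituting the leaf equations into the centre equation
    and cancelling the nonzero centre entry gives the quadratic of [star_radius]. *)
Lemma star_eigenvalue i : tnth rho i = t \/ tnth rho i <= alpha.
Proof.
set l := tnth rho i.
have : eigenvalue (A_alpha G alpha) l.
  case/andP: spec_rho => _ /eqP; rewrite eigenvalue_root_char => ->.
  by rewrite root_prod_XsubC mem_tnth.
case/eigenvalueP => v; rewrite -(map_mx_id (fun=> erefl) (A_alpha G alpha)).
move=> eig v0; have {}eig :
    v *m map_mx (idfun : {rmorphism R -> R}) (A_alpha G alpha) = l *: v by [].
have [->|la] := eqVneq l alpha; first by right.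
apply: star_radius_uniq => //.
have leaf := star_eigenvector_leaf eig.
have center := star_eigenvector_center eig; rewrite /= in leaf center.
have wc : v 0 (enum_rank c) != 0.
  by apply: contraNneq v0 => wc; rewrite (star_eigenvector_eq0 eig la wc).
apply: (mulIf wc); rewrite -mulrA center mulrCA mulr_sumr.
rewrite (eq_bigr (fun=> (1 - alpha) * v 0 (enum_rank c))) //.
rewrite sumr_const (_ : #|_| = deg c); first by rewrite -mulr_natr; ring.
by apply: eq_card => y; rewrite !inE sc eqxx.
Qed.

(** Two independent eigenvectors for [t] would have a nontrivial combination vanishing at the
    centre, which must be zero. *)
Lemma star_radius_simple i j : tnth rho i = t -> tnth rho j = t -> i = j.
Proof.
move=> ri rj; apply/eqP/negPn/negP => ij.
have [P PU PM] := spectrum_unitary_diag (A_alpha_sym G alpha) spec_rho.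
set d := \row_i _ in PM.
(* Here [u] holds coordinates with respect to the rows of [P], so [u *m P] is the actual
   eigenvector. *)
have inj (u : 'rV[R[i]]_#|G|) : u *m diag_mx d = t%:C *: u ->
    (u *m P) 0 (enum_rank c) = 0 -> u = 0.
  move=> ud uc; rewrite -[u](mulmxK (unitarymx_unit PU)).
  rewrite (star_eigenvector_eq0 (f := real_complex R) (l := t%:C) _ _ uc) ?mul0mx //.
    by rewrite -mulmxA PM mulmxA ud scalemxAl.
  by rewrite (inj_eq (fmorph_inj _)) gt_eqF // star_radius_gt_alpha.
have dE k : tnth rho k = t -> delta_mx 0 k *m diag_mx d = t%:C *: delta_mx 0 k
    :> 'rV_#|G|.
  move=> rk; rewrite mul_mx_diag; apply/matrixP => a b; rewrite !mxE mulrC.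
  by case: (b =P k) => [->|_]; rewrite ?rk // andbF !mulr0.
have dP k : ((delta_mx 0 k : 'rV_#|G|) *m P) 0 (enum_rank c) = P k (enum_rank c).
  by rewrite -rowE mxE.
(* The coefficients are chosen so that the centre entries of rows [i] and [j] cancel. *)
pose u : 'rV_#|G| := P j (enum_rank c) *: delta_mx 0 i
    - P i (enum_rank c) *: delta_mx 0 j.
have u0 : u = 0.
  apply: inj.
    rewrite mulmxBl -!scalemxAl !dE // scalerBr !scalerA.
    by congr (_ *: _ - _ *: _); rewrite mulrC.
  by rewrite mulmxBl -!scalemxAl 2!mxE dP [X in _ + X]mxE [X in - X]mxE dP mulrC subrr.
(* Coordinate [j] of [u = 0] shows that row [i] itself vanishes at the centre, so [inj] would make a
   unit vector zero. *)
have Pi : P i (enum_rank c) = 0.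
  move/matrixP/(_ 0 j): u0; rewrite !mxE !eqxx eq_sym (negPf ij) /= mulr0 mulr1 sub0r.
  by move/eqP; rewrite oppr_eq0 => /eqP.
have /matrixP/(_ 0 i)/eqP := inj _ (dE i ri) (etrans (dP i) Pi).
by rewrite !mxE !eqxx oner_eq0.
Qed.

End StarSpectrum.

(** * Absolute sums of families with zero total *)

Section CenteredSums.
Variables (R : realDomainType) (I : finType) (g : I -> R) (i0 : I).
Hypothesis sum0 : \sum_i g i = 0.

Let rest : \sum_(i | i != i0) g i = - g i0.
Proof.
by apply/eqP; rewrite -addr_eq0 addrC; move: sum0; rewrite (bigD1 i0) //= => ->.
Qed.

(** The other terms sum to [- g i0], so by the triangle inequality their absolute values contribute
    at least [g i0] again. *)
Lemma centered_sum_norm_ge : 2 * g i0 <= \sum_i `|g i|.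
Proof.
rewrite (bigD1 i0) //= mulr2n mulrDl mul1r lerD ?ler_norm //.
by rewrite (le_trans _ (ler_norm_sum _ _ _)) // rest normrN ler_norm.
Qed.

Lemma centered_sum_norm :
  (forall i, i != i0 -> g i <= 0) -> \sum_i `|g i| = 2 * g i0.
Proof.
move=> neg; have g0 : 0 <= g i0.
  by rewrite -[g i0]opprK -rest oppr_ge0 sumr_le0.
rewrite (bigD1 i0) //= (eq_bigr (fun i => - g i)) => [|i /neg/ler0_norm //].
by rewrite sumrN rest opprK ger0_norm // mulr2n mulrDl mul1r.
Qed.

End CenteredSums.

(** * Assembling the energy bound and its equality case *)

Lemma connected_deg_gt0 (G : sgraph) (x : G) :
  (forall x y : G, connect (@adj G) x y) -> (1 < #|G|)%N -> (0 < deg x)%N.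
Proof.
move=> conn G1; have /card_gt0P[y] : (0 < #|predC1 x|)%N.
  by rewrite cardC1 -subn1 subn_gt0.
rewrite inE /= => yx; have /connectP[[|z p] /= ] := conn x y.
  by move=> _ xy; rewrite xy eqxx in yx.
by case/andP=> xz _ _; rewrite card_gt0; apply/set0Pn; exists z; rewrite inE.
Qed.

Theorem theorem3p4 (R : rcfType) (G : sgraph) (n m Delta : nat) (alpha : R)
  (hn : n = #|G|) (hm : m = #|edges G|) (hDelta : Delta = max_deg G)
  (Gconn : connected_graph G) (n_ge3 : (3 <= n)%N)
  (alpha01 : 0 <= alpha < 1) :
  let bound : R :=
    (alpha * (Delta%:R + 1)
     + Num.sqrt (alpha ^+ 2 * (Delta%:R + 1) ^+ 2
                 + 4 * Delta%:R * (1 - 2 * alpha)))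
    - 4 * alpha * m%:R / n%:R in
  energy G alpha >= bound
  /\ (energy G alpha = bound <-> giso G (star Delta)).
Proof.
have [G0 conn] := Gconn.
have G1 : (1 < #|G|)%N by rewrite -hn ltnW.
set bound := (X in let _ := X in _) => /=.
set rh := eigenvalues (A_alpha_sym G alpha).
have specA : is_spectrum (A_alpha G alpha) rh by exact: xchooseP.
pose mean : R := 2 * alpha * #|edges G|%:R / #|G|%:R.
have boundE : bound = 2 * (star_radius alpha Delta%:R - mean).
  by rewrite /bound /mean /star_radius hm hn; field; rewrite pnatr_eq0 -lt0n.
pose g i := tnth rh i - mean.
have energyE : energy G alpha = \sum_i `|g i| by [].
have g0 : \sum_i g i = 0.
  rewrite sumrB (spectrum_trace specA) A_alpha_trace sumr_const card_ord.
  by rewrite -[mean *+ _]mulr_natr /mean divfK ?subrr // pnatr_eq0 -lt0n.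
have [i0 max_i0] : exists i0, forall i, tnth rh i <= tnth rh i0.
  case: (arg_maxP (fun i => tnth rh i) (isT : predT (Ordinal G0))) => i0 _ max_i0.
  by exists i0 => i; exact: max_i0.
have energy_ge : 2 * (tnth rh i0 - mean) <= energy G alpha.
  by rewrite energyE; exact: (centered_sum_norm_ge i0 g0).
have [c degc] := bigop.eq_bigmax (@deg G) G0; rewrite -/(max_deg G) -hDelta in degc.
have [t_le t_eq] := star_radius_le alpha01 (connected_deg_gt0 c conn G1)
  specA max_i0 conn.
rewrite -degc in t_le t_eq; split; first by rewrite boundE; lra.
split=> [E | ].
  (* The energy is at least twice the excess of the largest eigenvalue over the mean, so meeting the
     bound leaves no room above [star_radius]. *)
  have /t_eq sc : tnth rh i0 = star_radius alpha Delta%:R by lra.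
  by apply/giso_starP; [rewrite degc star_at_deg | exists c].
move=> iso; have DG : Delta.+1 = #|G|.
  by case: iso => h /bij_eq_card ->; rewrite card_ord.
have [a sa] := (giso_starP DG).1 iso.
have degA : deg a = Delta by rewrite hDelta (star_at_max_deg sa).
have dega : (0 < deg a)%N by exact: connected_deg_gt0.
have D1 : 1 <= Delta%:R :> R by rewrite ler1n -degA.
have a_lt := star_radius_gt_alpha alpha01 D1.
have ev := star_eigenvalue alpha01 dega sa specA; rewrite degA in ev.
have simple := star_radius_simple alpha01 dega sa specA; rewrite degA in simple.
(* The alternative, an eigenvalue at most [alpha], contradicts [a_lt] and [t_le]. *)
have r0 : tnth rh i0 = star_radius alpha Delta%:R by case: (ev i0) => //; lra.
(* The mean is [alpha] times the average degree, and every degree is at least 1. *)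
have mean_ge : alpha <= mean.
  case/andP: alpha01 => a0 _.
  rewrite /mean ler_pdivlMr ?ltr0n // mulrAC -natrM mulrC ler_wpM2r //.
  rewrite ler_nat -handshake -sum1_card leq_sum // => x _.
  exact: connected_deg_gt0.
rewrite energyE boundE -r0; apply: centered_sum_norm => // i ii0.
rewrite subr_le0; case: (ev i) => [ri|ri]; last exact: le_trans mean_ge.
by rewrite (simple _ _ ri r0) eqxx in ii0.
Qed.
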